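(* Let $\mathcal{C}$ be a category with pullbacks and $\mathbb{T}=(T,\eta,\mu)$ a monad on $\mathcal{C}$. Assume that $\mathcal{C}$ also admits coequalizers of reflexive pairs and that these are stable under pullback and are preserved by $T$. Then, for every $\mathbb{T}$-category $B$, the full subcategory $\mathsf{Perf}(\mathbb{T})/B$ is reflective in the slice category $\mathsf{Cat}(\mathbb{T})/B$.
   Context: Composition is written $g\cdot f$ ($f$ first). A pair of parallel morphisms is reflexive if the two morphisms admit a common section. Stability under pullback means: pulling back a coequalizer diagram $X\rightrightarrows Y\to Z$ of a reflexive pair along any morphism $Z'\to Z$ yields again a coequalizer diagram. A $\mathbb{T}$-graph $A=(A_0,A_1,d_0,c_0)$ is a pair of morphisms $d_0:A_1\to TA_0$, $c_0:A_1\to A_0$ in $\mathcal{C}$. A morphism $f=(f_0,f_1):A\to B$ of $\mathbb{T}$-graphs consists of $f_0:A_0\to B_0$, $f_1:A_1\to B_1$ with $d_0^B\cdot f_1=Tf_0\cdot d_0^A$ and $c_0^B\cdot f_1=f_0\cdot c_0^A$. A pointed $\mathbb{T}$-graph $(A,i)$ is a $\mathbb{T}$-graph $A$ with a morphism $i:A_0\to A_1$ such that $d_0\cdot i=\eta_{A_0}$ and $c_0\cdot i=1_{A_0}$. Morphisms of pointed $\mathbb{T}$-graphs are $\mathbb{T}$-graph morphisms $f$ with $f_1\cdot i^A=i^B\cdot f_0$. For a pointed $\mathbb{T}$-graph $(A,i)$, let $A_2$ be the pullback of $Tc_0:TA_1\to TA_0$ and $d_0:A_1\to TA_0$, with projections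 $d_1:A_2\to TA_1$, $c_1:A_2\to A_1$ (so $Tc_0\cdot d_1=d_0\cdot c_1$), and let $A_3$ be the pullback of $Tc_1:TA_2\to TA_1$ and $d_1:A_2\to TA_1$, with projections $d_2:A_3\to TA_2$, $c_2:A_3\to A_2$ (so $Tc_1\cdot d_2=d_1\cdot c_2$). Morphisms $i_1,i_2:A_1\to A_2$ are determined by $d_1\cdot i_1=Ti\cdot d_0$, $c_1\cdot i_1=1_{A_1}$, $d_1\cdot i_2=\eta_{A_1}$, $c_1\cdot i_2=i\cdot c_0$. A $\mathbb{T}$-category $(A,i,m)$ is a pointed $\mathbb{T}$-graph $(A,i)$ with a morphism $m:A_2\to A_1$ such that $d_0\cdot m=\mu_{A_0}\cdot Td_0\cdot d_1$, $c_0\cdot m=c_0\cdot c_1$, $m\cdot i_1=1_{A_1}=m\cdot i_2$, and $m\cdot m_1=m\cdot m_2$, where $m_1,m_2:A_3\to A_2$ are determined by $d_1\cdot m_1=Tm\cdot d_2$, $c_1\cdot m_1=c_1\cdot c_2$, $d_1\cdot m_2=\mu_{A_1}\cdot Td_1\cdot d_2$, $c_1\cdot m_2=m\cdot c_2$. A $\mathbb{T}$-functor $f:A\to B$ is a morphism of pointed $\mathbb{T}$-graphs with $f_1\cdot m^A=m^B\cdot f_2$, where $f_2:A_2\to B_2$ is determined by $d_1^B\cdot f_2=Tf_1\cdot d_1^A$, $c_1^B\cdot f_2=f_1\cdot c_1^A$. $\mathbb{T}$-categories and $\mathbb{T}$-functors form $\mathsf{Cat}(\mathbb{T})$. A $\mathbb{T}$-functor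 $f:A\to B$ is perfect (a discrete cofibration) if the square $d_0^B\cdot f_1=Tf_0\cdot d_0^A$ is a pullback diagram in $\mathcal{C}$, i.e. exhibits $A_1$ as the pullback of $Tf_0:TA_0\to TB_0$ and $d_0^B:B_1\to TB_0$, with projections $d_0^A$ and $f_1$. $\mathsf{Perf}(\mathbb{T})$ is the class of perfect $\mathbb{T}$-functors, and $\mathsf{Perf}(\mathbb{T})/B$ is the full subcategory of $\mathsf{Cat}(\mathbb{T})/B$ whose objects are the perfect $\mathbb{T}$-functors with codomain $B$. *)

(* Defs.v *)
From Stdlib Require Import ProofIrrelevance.

Set Implicit Arguments.
Unset Strict Implicit.
Unset Printing Implicit Defensive.

Record Category := {
  Ob :> Type;
  Hom : Ob -> Ob -> Type;
  idm : forall X, Hom X X;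
  comp : forall X Y Z, Hom Y Z -> Hom X Y -> Hom X Z;
  comp_idl : forall X Y (f : Hom X Y), comp (idm Y) f = f;
  comp_idr : forall X Y (f : Hom X Y), comp f (idm X) = f;
  comp_assoc : forall W X Y Z (h : Hom Y Z) (g : Hom X Y) (f : Hom W X),
    comp h (comp g f) = comp (comp h g) f
}.

Arguments Hom {c} X Y.
Arguments idm {c} X.
Arguments comp {c X Y Z} g f.

Declare Scope cat_scope.
Delimit Scope cat_scope with cat.
Open Scope cat_scope.
Notation "g ∘ f" := (comp g f) (at level 40, left associativity) : cat_scope.

Record Functor (C D : Category) := {
  fobj :> C -> D;
  fmap : forall X Y : C, Hom X Y -> Hom (fobj X) (fobj Y);
  fmap_id : forall X : C, fmap (idm X) = idm (fobj X);
  fmap_comp : forall (X Y Z : C) (g : Hom Y Z) (f : Hom X Y),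
    fmap (g ∘ f) = fmap g ∘ fmap f
}.

Arguments fmap {C D} F {X Y} f : rename.

Record Adjunction (C D : Category) (L : Functor C D) (R : Functor D C) := {
  adj_right : forall (X : C) (Y : D), Hom (L X) Y -> Hom X (R Y);
  adj_left : forall (X : C) (Y : D), Hom X (R Y) -> Hom (L X) Y;
  adj_leftK : forall (X : C) (Y : D) (f : Hom X (R Y)),
    adj_right (adj_left f) = f;
  adj_rightK : forall (X : C) (Y : D) (g : Hom (L X) Y),
    adj_left (adj_right g) = g;
  adj_natural : forall (X X' : C) (Y Y' : D)
      (u : Hom X' X) (v : Hom Y Y') (g : Hom (L X) Y),
    adj_right (v ∘ g ∘ fmap L u) = fmap R v ∘ adj_right g ∘ u
}.

Section FullSubcategory.
Variables (C : Category) (P : C -> Prop).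

Definition FullSub : Category := {|
  Ob := {X : C | P X};
  Hom := fun X Y => Hom (proj1_sig X) (proj1_sig Y);
  idm := fun X => idm (proj1_sig X);
  comp := fun _ _ _ g f => g ∘ f;
  comp_idl := fun _ _ f => comp_idl f;
  comp_idr := fun _ _ f => comp_idr f;
  comp_assoc := fun _ _ _ _ h g f => comp_assoc h g f
|}.

Definition inclusion : Functor FullSub C := {|
  fobj := fun X : FullSub => proj1_sig X;
  fmap := fun _ _ f => f;
  fmap_id := fun _ => eq_refl;
  fmap_comp := fun _ _ _ _ _ => eq_refl
|}.

Definition reflective : Prop :=
  exists L : Functor C FullSub, inhabited (Adjunction L inclusion).

End FullSubcategory.

Section SliceCategory.
Variables (C : Category) (B : C).

Record SliceOb := { slice_dom : C; slice_arr : Hom slice_dom B }.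

Record SliceHom (X Y : SliceOb) := {
  slice_map : Hom (slice_dom X) (slice_dom Y);
  slice_comm : slice_arr Y ∘ slice_map = slice_arr X
}.

Lemma slice_hom_eq X Y (f g : SliceHom X Y) :
  slice_map f = slice_map g -> f = g.
Proof.
destruct f as [f Hf], g as [g Hg]; simpl; intros e; subst g.
now rewrite (proof_irrelevance _ Hf Hg).
Qed.

Definition slice_id (X : SliceOb) : SliceHom X X :=
  {| slice_map := idm (slice_dom X); slice_comm := comp_idr (slice_arr X) |}.

Lemma slice_comp_comm X Y Z (g : SliceHom Y Z) (f : SliceHom X Y) :
  slice_arr Z ∘ (slice_map g ∘ slice_map f) = slice_arr X.
Proof. now rewrite comp_assoc, slice_comm, slice_comm. Qed.

Definition slice_comp X Y Z (g : SliceHom Y Z) (f : SliceHom X Y) :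
    SliceHom X Z :=
  {| slice_map := slice_map g ∘ slice_map f;
     slice_comm := slice_comp_comm g f |}.

Definition Slice : Category.
Proof.
refine {| Ob := SliceOb; Hom := SliceHom; idm := slice_id;
          comp := slice_comp |}; intros; apply slice_hom_eq; simpl.
- apply comp_idl.
- apply comp_idr.
- apply comp_assoc.
Defined.

End SliceCategory.

Section Limits.
Variable C : Category.

Definition is_pullback (X Y Z P : C) (f : Hom X Z) (g : Hom Y Z)
    (p : Hom P X) (q : Hom P Y) : Prop :=
  f ∘ p = g ∘ q /\
  forall (Q : C) (u : Hom Q X) (v : Hom Q Y), f ∘ u = g ∘ v ->
    exists! w : Hom Q P, p ∘ w = u /\ q ∘ w = v.

(* The mediating morphism is carried as data; being unique, it adds no
   structure beyond a choice of the pullback cone. *)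
Record Pullback (X Y Z : C) (f : Hom X Z) (g : Hom Y Z) := {
  pb_ob : C;
  pb_fst : Hom pb_ob X;
  pb_snd : Hom pb_ob Y;
  pb_comm : f ∘ pb_fst = g ∘ pb_snd;
  pb_lift : forall (Q : C) (u : Hom Q X) (v : Hom Q Y),
    f ∘ u = g ∘ v -> Hom Q pb_ob;
  pb_fst_lift : forall (Q : C) (u : Hom Q X) (v : Hom Q Y)
    (e : f ∘ u = g ∘ v), pb_fst ∘ pb_lift e = u;
  pb_snd_lift : forall (Q : C) (u : Hom Q X) (v : Hom Q Y)
    (e : f ∘ u = g ∘ v), pb_snd ∘ pb_lift e = v;
  pb_unique : forall (Q : C) (w w' : Hom Q pb_ob),
    pb_fst ∘ w = pb_fst ∘ w' -> pb_snd ∘ w = pb_snd ∘ w' -> w = w'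
}.

Definition Pullbacks : Type :=
  forall (X Y Z : C) (f : Hom X Z) (g : Hom Y Z), Pullback f g.

Definition reflexive_pair (X Y : C) (f g : Hom X Y) : Prop :=
  exists s : Hom Y X, f ∘ s = idm Y /\ g ∘ s = idm Y.

Definition is_coequalizer (X Y Z : C) (f g : Hom X Y) (q : Hom Y Z) : Prop :=
  q ∘ f = q ∘ g /\
  forall (W : C) (h : Hom Y W), h ∘ f = h ∘ g ->
    exists! k : Hom Z W, k ∘ q = h.

Definition has_reflexive_coequalizers : Prop :=
  forall (X Y : C) (f g : Hom X Y), reflexive_pair f g ->
    exists (Z : C) (q : Hom Y Z), is_coequalizer f g q.

(* X' is the pullback of the common composite q ∘ f = q ∘ g : X -> Z along h,
   Y' that of q; f' and g' are the morphisms induced by f and g. *)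
Definition reflexive_coequalizers_pullback_stable : Prop :=
  forall (X Y Z : C) (f g : Hom X Y) (q : Hom Y Z),
  reflexive_pair f g -> is_coequalizer f g q ->
  forall (Z' : C) (h : Hom Z' Z)
    (Y' : C) (hY : Hom Y' Y) (q' : Hom Y' Z')
    (X' : C) (hX : Hom X' X) (r' : Hom X' Z')
    (f' g' : Hom X' Y'),
  is_pullback q h hY q' -> is_pullback (q ∘ f) h hX r' ->
  hY ∘ f' = f ∘ hX -> q' ∘ f' = r' ->
  hY ∘ g' = g ∘ hX -> q' ∘ g' = r' ->
  is_coequalizer f' g' q'.

End Limits.

Definition preserves_reflexive_coequalizers (C D : Category)
    (F : Functor C D) : Prop :=
  forall (X Y Z : C) (f g : Hom X Y) (q : Hom Y Z),
  reflexive_pair f g -> is_coequalizer f g q ->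
  is_coequalizer (fmap F f) (fmap F g) (fmap F q).

Record Monad (C : Category) := {
  monad_functor :> Functor C C;
  eta : forall X : C, Hom X (monad_functor X);
  mu : forall X : C, Hom (monad_functor (monad_functor X)) (monad_functor X);
  eta_natural : forall (X Y : C) (f : Hom X Y),
    eta Y ∘ f = fmap monad_functor f ∘ eta X;
  mu_natural : forall (X Y : C) (f : Hom X Y),
    mu Y ∘ fmap monad_functor (fmap monad_functor f)
    = fmap monad_functor f ∘ mu X;
  mu_eta_l : forall X : C, mu X ∘ eta (monad_functor X) = idm _;
  mu_eta_r : forall X : C, mu X ∘ fmap monad_functor (eta X) = idm _;
  mu_assoc : forall X : C,
    mu X ∘ fmap monad_functor (mu X) = mu X ∘ mu (monad_functor X)
}.

Arguments eta {C} T X : rename.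
Arguments mu {C} T X : rename.

Section TCategories.
Variables (C : Category) (pb : Pullbacks C) (T : Monad C).

Record TGraph := {
  A0 : C;
  A1 : C;
  d0 : Hom A1 (T A0);
  c0 : Hom A1 A0
}.

Record PointedTGraph := {
  pt_graph :> TGraph;
  pt : Hom (A0 pt_graph) (A1 pt_graph);
  d0_pt : d0 pt_graph ∘ pt = eta T (A0 pt_graph);
  c0_pt : c0 pt_graph ∘ pt = idm (A0 pt_graph)
}.

Section Composables.
Variable A : TGraph.

Definition pb2 : Pullback (fmap T (c0 A)) (d0 A) := pb (fmap T (c0 A)) (d0 A).
Definition A2 : C := pb_ob pb2.
Definition d1 : Hom A2 (T (A1 A)) := pb_fst pb2.
Definition c1 : Hom A2 (A1 A) := pb_snd pb2.

Lemma d1_c1 : fmap T (c0 A) ∘ d1 = d0 A ∘ c1.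
Proof. exact (pb_comm pb2). Qed.

Definition pb3 : Pullback (fmap T c1) d1 := pb (fmap T c1) d1.
Definition A3 : C := pb_ob pb3.
Definition d2 : Hom A3 (T A2) := pb_fst pb3.
Definition c2 : Hom A3 A2 := pb_snd pb3.

Lemma d2_c2 : fmap T c1 ∘ d2 = d1 ∘ c2.
Proof. exact (pb_comm pb3). Qed.

End Composables.

Section Units.
Variable A : PointedTGraph.

Lemma i1_comm :
  fmap T (c0 A) ∘ (fmap T (pt A) ∘ d0 A) = d0 A ∘ idm (A1 A).
Proof.
now rewrite comp_assoc, <- fmap_comp, c0_pt, fmap_id, comp_idl, comp_idr.
Qed.

Definition i1 : Hom (A1 A) (A2 A) := pb_lift (pb2 A) i1_comm.

Lemma i2_comm :
  fmap T (c0 A) ∘ eta T (A1 A) = d0 A ∘ (pt A ∘ c0 A).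
Proof. now rewrite comp_assoc, d0_pt, eta_natural. Qed.

Definition i2 : Hom (A1 A) (A2 A) := pb_lift (pb2 A) i2_comm.

End Units.

Section Associativity.
Variables (A : TGraph) (m : Hom (A2 A) (A1 A)).
Hypothesis d0_m : d0 A ∘ m = mu T (A0 A) ∘ fmap T (d0 A) ∘ d1 A.
Hypothesis c0_m : c0 A ∘ m = c0 A ∘ c1 A.

Lemma m1_comm :
  fmap T (c0 A) ∘ (fmap T m ∘ d2 A) = d0 A ∘ (c1 A ∘ c2 A).
Proof.
rewrite comp_assoc, <- fmap_comp, c0_m, fmap_comp.
now rewrite <- comp_assoc, d2_c2, comp_assoc, d1_c1, comp_assoc.
Qed.

Definition m1 : Hom (A3 A) (A2 A) := pb_lift (pb2 A) m1_comm.

Lemma m2_comm :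
  fmap T (c0 A) ∘ (mu T (A1 A) ∘ fmap T (d1 A) ∘ d2 A) = d0 A ∘ (m ∘ c2 A).
Proof.
rewrite (comp_assoc (d0 A)), d0_m.
rewrite !comp_assoc, <- mu_natural.
rewrite <- (comp_assoc _ _ (fmap T (d1 A))), <- fmap_comp, d1_c1, fmap_comp.
now rewrite <- !comp_assoc, d2_c2.
Qed.

Definition m2 : Hom (A3 A) (A2 A) := pb_lift (pb2 A) m2_comm.

End Associativity.

Record TCategory := {
  tcat_graph :> PointedTGraph;
  mult : Hom (A2 tcat_graph) (A1 tcat_graph);
  d0_mult : d0 tcat_graph ∘ mult
            = mu T (A0 tcat_graph) ∘ fmap T (d0 tcat_graph) ∘ d1 tcat_graph;
  c0_mult : c0 tcat_graph ∘ mult = c0 tcat_graph ∘ c1 tcat_graph;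
  mult_i1 : mult ∘ i1 tcat_graph = idm (A1 tcat_graph);
  mult_i2 : mult ∘ i2 tcat_graph = idm (A1 tcat_graph);
  mult_assoc : mult ∘ m1 c0_mult = mult ∘ m2 d0_mult
}.

Record TGraphHom (A B : TGraph) := {
  f0 : Hom (A0 A) (A0 B);
  f1 : Hom (A1 A) (A1 B);
  d0_f1 : d0 B ∘ f1 = fmap T f0 ∘ d0 A;
  c0_f1 : c0 B ∘ f1 = f0 ∘ c0 A
}.

Lemma f2_comm (A B : TGraph) (f : TGraphHom A B) :
  fmap T (c0 B) ∘ (fmap T (f1 f) ∘ d1 A) = d0 B ∘ (f1 f ∘ c1 A).
Proof.
rewrite !comp_assoc, <- fmap_comp, c0_f1, d0_f1, fmap_comp.
now rewrite <- !comp_assoc, d1_c1.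
Qed.

Definition f2 (A B : TGraph) (f : TGraphHom A B) : Hom (A2 A) (A2 B) :=
  pb_lift (pb2 B) (f2_comm f).

Record TFunctor (A B : TCategory) := {
  tfun_hom :> TGraphHom A B;
  f1_pt : f1 tfun_hom ∘ pt A = pt B ∘ f0 tfun_hom;
  f1_mult : f1 tfun_hom ∘ mult A = mult B ∘ f2 tfun_hom
}.

Definition perfect (A B : TCategory) (f : TFunctor A B) : Prop :=
  is_pullback (fmap T (f0 f)) (d0 B) (d0 A) (f1 f).

Lemma tfunctor_eq (A B : TCategory) (f g : TFunctor A B) :
  f0 f = f0 g -> f1 f = f1 g -> f = g.
Proof.
destruct f as [[u v a b] p q], g as [[u' v' a' b'] p' q']; simpl.
intros e e'; subst u' v'.
destruct (proof_irrelevance _ a a'), (proof_irrelevance _ b b').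
now rewrite (proof_irrelevance _ p p'), (proof_irrelevance _ q q').
Qed.

Definition tgraph_id (A : TGraph) : TGraphHom A A.
Proof.
refine {| f0 := idm (A0 A); f1 := idm (A1 A) |}.
- now rewrite fmap_id, comp_idl, comp_idr.
- now rewrite comp_idl, comp_idr.
Defined.

Definition tgraph_comp (A B D : TGraph)
    (g : TGraphHom B D) (f : TGraphHom A B) : TGraphHom A D.
Proof.
refine {| f0 := f0 g ∘ f0 f; f1 := f1 g ∘ f1 f |}.
- now rewrite comp_assoc, d0_f1, fmap_comp, <- !comp_assoc, d0_f1.
- now rewrite comp_assoc, c0_f1, <- !comp_assoc, c0_f1.
Defined.

Lemma d1_f2 (A B : TGraph) (f : TGraphHom A B) :
  d1 B ∘ f2 f = fmap T (f1 f) ∘ d1 A.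
Proof. exact (pb_fst_lift (pb2 B) (f2_comm f)). Qed.

Lemma c1_f2 (A B : TGraph) (f : TGraphHom A B) : c1 B ∘ f2 f = f1 f ∘ c1 A.
Proof. exact (pb_snd_lift (pb2 B) (f2_comm f)). Qed.

Lemma f2_id (A : TGraph) : f2 (tgraph_id A) = idm (A2 A).
Proof.
apply (pb_unique (p := pb2 A)).
- change (d1 A ∘ f2 (tgraph_id A) = d1 A ∘ idm (A2 A)).
  rewrite d1_f2; simpl; now rewrite fmap_id, comp_idl, comp_idr.
- change (c1 A ∘ f2 (tgraph_id A) = c1 A ∘ idm (A2 A)).
  rewrite c1_f2; simpl; now rewrite comp_idl, comp_idr.
Qed.

Lemma f2_comp (A B D : TGraph) (g : TGraphHom B D) (f : TGraphHom A B) :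
  f2 (tgraph_comp g f) = f2 g ∘ f2 f.
Proof.
apply (pb_unique (p := pb2 D)).
- change (d1 D ∘ f2 (tgraph_comp g f) = d1 D ∘ (f2 g ∘ f2 f)).
  rewrite d1_f2, comp_assoc, d1_f2, <- comp_assoc, d1_f2; simpl.
  now rewrite fmap_comp, comp_assoc.
- change (c1 D ∘ f2 (tgraph_comp g f) = c1 D ∘ (f2 g ∘ f2 f)).
  rewrite c1_f2, comp_assoc, c1_f2, <- comp_assoc, c1_f2; simpl.
  now rewrite comp_assoc.
Qed.

Definition tfunctor_id (A : TCategory) : TFunctor A A.
Proof.
refine {| tfun_hom := tgraph_id A |}.
- simpl; now rewrite comp_idl, comp_idr.
- rewrite f2_id; simpl; now rewrite comp_idl, comp_idr.
Defined.

Definition tfunctor_comp (A B D : TCategory)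
    (g : TFunctor B D) (f : TFunctor A B) : TFunctor A D.
Proof.
refine {| tfun_hom := tgraph_comp g f |}.
- simpl; now rewrite <- comp_assoc, f1_pt, comp_assoc, f1_pt, comp_assoc.
- rewrite f2_comp; simpl.
  now rewrite <- comp_assoc, f1_mult, comp_assoc, f1_mult, comp_assoc.
Defined.

Definition CatT : Category.
Proof.
refine {| Ob := TCategory; Hom := TFunctor; idm := tfunctor_id;
          comp := tfunctor_comp |}; intros; apply tfunctor_eq; simpl.
- apply comp_idl.
- apply comp_idl.
- apply comp_idr.
- apply comp_idr.
- apply comp_assoc.
- apply comp_assoc.
Defined.

Definition perfect_over (B : CatT) (X : Slice B) : Prop :=
  perfect (slice_arr X).

End TCategories.

(* Main.v *)
From Stdlib Require Import ClassicalEpsilon.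
Require Import Defs.

Set Implicit Arguments.
Unset Strict Implicit.
Unset Printing Implicit Defensive.

(** Let [B] be a T-category.  The families over [B], that is, the objects
    [x : X -> B0] of the slice over its object of objects, carry a monad

      [Arr (X, x)  =  T X  x_{T B0}  B1],

    the pairs of a T-source in [X] and an arrow of [B] out of its image, lying
    over [B0] by the target of the arrow; unit and multiplication come from the
    identities and the composition of [B].

    A perfect functor [Y -> B] is the same thing as an [Arr]-algebra.  Perfection
    says that [Y1] is [Arr Y0], so that the target map of [Y] becomes an action
    [Arr Y0 -> Y0], whose unit and associativity laws are equivalent to those of
    [Y] ([perfect_algebra], [alg_cat]).  A functor from [f : A -> B] to such a
    [Y] over [B] is determined by its object part [h : A0 -> Y0], because its
    arrow part is forced by the pullback [Y1].  An [h] over [B0] extends to a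
    functor as soon as it respects targets, which says that acting on [h] by the
    image in [B] of an arrow [t] of [A] gives [h] of the target of [t]; the laws
    of a functor then hold because they can be tested in [B]
    ([functor_compatible], [compatible_functor]).

    So reflecting [f : A -> B] amounts to finding the universal [Arr]-algebra
    under [A0] in which the two composites from [A1] agree.  It is a coequalizer
    of free algebras [Arr A1 => Arr A0], and this pair is reflexive by the
    identities of [A].  Reflexive coequalizers of the slice are computed in the
    base category; [Arr] preserves them because T does and because [Arr] applied
    to a map is a pullback of T applied to it, so that the stability hypothesis
    applies ([arr_preserves_reflexive_coequalizers]).  A monad that preserves a
    coequalizer lets its vertex inherit an algebra structure
    ([universal_compatible_algebra]).  In the case of ordinary categories this
    computes the left Kan extension of the terminal functor along [f], the
    connected components of the comma categories [f / b]. *)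

Lemma postcomp_eq (C : Category) (X Y Z W : C) (g : Hom Y Z) (f : Hom X Y)
    (k : Hom X Z) (h : Hom Z W) :
  g ∘ f = k -> h ∘ g ∘ f = h ∘ k.
Proof. now intros <-; rewrite comp_assoc. Qed.

Lemma fmap_eq (C D : Category) (F : Functor C D) (X Y Z : C) (g : Hom Y Z)
    (f : Hom X Y) (k : Hom X Z) :
  g ∘ f = k -> fmap F g ∘ fmap F f = fmap F k.
Proof. now intros <-; rewrite fmap_comp. Qed.

(* Rewriting with an equation between composites inside a longer composite
   that is bracketed to the left. *)
Tactic Notation "rw" uconstr(e) :=
  (rewrite e || rewrite (postcomp_eq _ e)); rewrite ?comp_assoc.

(** * Reflections from universal arrows *)

(** The objects are only assumed to have some universal arrow; a choice of one for
    each object is made here, and turns them into a functor. *)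
Lemma reflective_of_universal_arrows (D : Category) (P : D -> Prop) :
  (forall X : D, exists (Y : D) (u : Hom X Y), P Y /\
     forall (Z : D) (g : Hom X Z), P Z -> exists! k : Hom Y Z, k ∘ u = g) ->
  reflective P.
Proof.
intros H.
assert (H' : forall X : D, {R : FullSub P & {u : Hom X (proj1_sig R) |
   forall (Z : FullSub P) (g : Hom X (proj1_sig Z)),
     exists! k : Hom (proj1_sig R) (proj1_sig Z), k ∘ u = g}}).
{ intros X.
  destruct (constructive_indefinite_description _ (H X)) as [Y HY].
  destruct (constructive_indefinite_description _ HY) as [u [p U]].
  exists (exist _ Y p), u; intros [Z pZ] g; exact (U Z g pZ). }
pose (L := fun X => projT1 (H' X)).
pose (u := fun X => proj1_sig (projT2 (H' X)) : Hom X (proj1_sig (L X))).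
assert (U : forall X (Z : FullSub P) (g : Hom X (proj1_sig Z)),
  exists! k : Hom (L X) Z, comp (c := D) k (u X) = g)
  by (intros X; exact (proj2_sig (projT2 (H' X)))).
clearbody u; clearbody L; clear H H'.
pose (ext := fun X (Z : FullSub P) (g : Hom X (proj1_sig Z)) =>
  proj1_sig (constructive_indefinite_description _ (U X Z g))
  : Hom (proj1_sig (L X)) (proj1_sig Z)).
assert (extK : forall X Z (g : Hom X (proj1_sig Z)),
  ext X Z g ∘ u X = g).
{ intros X Z g; exact (proj1 (proj2_sig
    (constructive_indefinite_description _ (U X Z g)))). }
assert (ext_eq : forall X (Z : FullSub P)
    (k k' : Hom (proj1_sig (L X)) (proj1_sig Z)),
  k ∘ u X = k' ∘ u X -> k = k').
{ intros X Z k k' e; destruct (U X Z (k' ∘ u X)) as [w [_ Uw]].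
  now rewrite <- (Uw k e), <- (Uw k' eq_refl). }
clearbody ext.
unshelve epose (LF := Build_Functor (D := FullSub P) (fobj := L)
  (fmap := fun X Y f => ext X (L Y) (u Y ∘ f)) _ _).
- intros X; apply ext_eq; rewrite extK; simpl.
  now rewrite comp_idl, comp_idr.
- intros X Y Z g f; apply ext_eq; rewrite extK; simpl.
  now rewrite <- comp_assoc, extK, !comp_assoc, extK.
- exists LF; constructor.
  refine (@Build_Adjunction D (FullSub P) LF (inclusion P)
    (fun X (Y : FullSub P) (k : Hom (proj1_sig (L X)) (proj1_sig Y)) =>
       k ∘ u X) ext _ _ _); simpl.
  + intros X Y g; apply extK.
  + intros X Y k; apply ext_eq; apply extK.
  + intros X X' Y Y' f v g; now rewrite <- !comp_assoc, extK.
Qed.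

(** * Reflexive coequalizers *)

Lemma coequalizer_epi (C : Category) (X Y Z W : C) (f g : Hom X Y)
    (q : Hom Y Z) (k k' : Hom Z W) :
  is_coequalizer f g q -> k ∘ q = k' ∘ q -> k = k'.
Proof.
intros [e U] E; destruct (U W (k' ∘ q)) as [w [_ Uw]].
- now rewrite <- !comp_assoc, e.
- now rewrite <- (Uw k E), <- (Uw k' eq_refl).
Qed.

Lemma reflexive_pair_fmap (C D : Category) (F : Functor C D) (X Y : C)
    (f g : Hom X Y) :
  reflexive_pair f g -> reflexive_pair (fmap F f) (fmap F g).
Proof.
intros [s [a b]]; exists (fmap F s).
now rewrite <- !fmap_comp, a, b, fmap_id.
Qed.

Section SliceCoequalizers.
Variables (C : Category) (B : C).

Lemma slice_reflexive_pair (X Y : Slice B) (f g : Hom X Y) :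
  reflexive_pair f g -> reflexive_pair (slice_map f) (slice_map g).
Proof.
intros [s [a b]]; exists (slice_map s); split.
- exact (f_equal (@slice_map C B Y Y) a).
- exact (f_equal (@slice_map C B Y Y) b).
Qed.

(** The comparison map automatically lies over the base, because the coequalizing
    map is epic. *)
Lemma slice_coequalizer (X Y Z : Slice B) (f g : Hom X Y) (q : Hom Y Z) :
  is_coequalizer (slice_map f) (slice_map g) (slice_map q) ->
  is_coequalizer f g q.
Proof.
intros H; pose proof H as [e U]; split; [now apply slice_hom_eq|].
intros W h eh.
destruct (U _ (slice_map h) (f_equal (@slice_map C B X W) eh))
  as [k [Hk Uk]].
assert (over : slice_arr W ∘ k = slice_arr Z).
{ apply (coequalizer_epi H); rewrite <- comp_assoc, Hk.
  now rewrite (slice_comm h), (slice_comm q). }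
exists (Build_SliceHom over); split.
- now apply slice_hom_eq.
- intros k' <-; apply slice_hom_eq; now apply Uk.
Qed.

Hypothesis coeq : has_reflexive_coequalizers C.

Lemma slice_coequalizer_exists (X Y : Slice B) (f g : Hom X Y) :
  reflexive_pair f g ->
  exists (Z : Slice B) (q : Hom Y Z),
    is_coequalizer (slice_map f) (slice_map g) (slice_map q).
Proof.
intros r; destruct (coeq (slice_reflexive_pair r)) as [Z [q Hq]].
destruct (proj2 Hq _ (slice_arr Y)) as [z [Hz _]].
- now rewrite (slice_comm f), (slice_comm g).
- exists {| slice_dom := Z; slice_arr := z |}.
  now exists (Build_SliceHom (Y := {| slice_arr := z |}) Hz).
Qed.

Lemma slice_has_reflexive_coequalizers : has_reflexive_coequalizers (Slice B).
Proof.
intros X Y f g r; destruct (slice_coequalizer_exists r) as [Z [q Hq]].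
exists Z, q; now apply slice_coequalizer.
Qed.

(** A coequalizer in the slice is isomorphic to the one computed in the base
    category, which exists, so the forgetful functor preserves it. *)
Lemma slice_coequalizer_underlying (X Y Z : Slice B) (f g : Hom X Y)
    (q : Hom Y Z) :
  reflexive_pair f g -> is_coequalizer f g q ->
  is_coequalizer (slice_map f) (slice_map g) (slice_map q).
Proof.
intros r Hq; destruct (slice_coequalizer_exists r) as [Z' [q' Hq']].
pose proof (slice_coequalizer Hq') as Sq'.
destruct (proj2 Hq _ q' (proj1 Sq')) as [k [Hk _]].
destruct (proj2 Sq' _ q (proj1 Hq)) as [l [Hl _]].
assert (lk : l ∘ k = idm Z).
{ apply (coequalizer_epi Hq); now rewrite <- comp_assoc, Hk, Hl, comp_idl. }
apply (f_equal (@slice_map C B Z Z)) in lk; simpl in lk.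
apply (f_equal (@slice_map C B Y Z')) in Hk; simpl in Hk.
apply (f_equal (@slice_map C B Y Z)) in Hl; simpl in Hl.
split; [exact (f_equal (@slice_map C B X Z) (proj1 Hq))|].
intros W h eh; destruct (proj2 Hq' _ h eh) as [w [Hw Uw]].
exists (w ∘ slice_map k); split; [now rewrite <- comp_assoc, Hk|].
intros w' <-; rewrite (Uw (w' ∘ slice_map l)).
- now rewrite <- comp_assoc, lk, comp_idr.
- now rewrite <- comp_assoc, Hl.
Qed.

End SliceCoequalizers.

(** * Free algebras on graphs in the Kleisli category *)

Record Algebra (D : Category) (S : Monad D) := {
  alg_ob :> D;
  alg_str : Hom (S alg_ob) alg_ob;
  alg_unit : alg_str ∘ eta S alg_ob = idm alg_ob;
  alg_assoc : alg_str ∘ fmap S alg_str = alg_str ∘ mu S alg_ob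
}.

Section AlgebraCoequalizer.
Variables (D : Category) (S : Monad D).
Hypothesis coeq : has_reflexive_coequalizers D.
Hypothesis coeq_preserved : preserves_reflexive_coequalizers S.

(** Think of [E] as the arrows of a graph on [V], with targets [c] and with
    T-sources and labels [r].  An arrow acts on [h] of its sources through the
    algebra structure, and the result has to be [h] of its target. *)
Definition compatible (V E : D) (c : Hom E V) (r : Hom E (S V))
    (X : Algebra S) (h : Hom V X) : Prop :=
  alg_str X ∘ fmap S h ∘ r = h ∘ c.

Definition algebra_hom (X Y : Algebra S) (k : Hom X Y) : Prop :=
  k ∘ alg_str X = alg_str Y ∘ fmap S k.

(** [c] and [r] induce two algebra maps [S E => S V] between free algebras,
    namely [S c] and the Kleisli extension of [r], and [h] is compatible exactly
    when its extension to [S V] coequalizes them.  The common section [i] makes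
    the pair reflexive, hence [S] preserves its coequalizer [q : S V -> X]: since
    [S q] is a coequalizer too, the free structure on [S V] descends to [X], and
    since [S S q] is epic, so do the laws. *)
Lemma universal_compatible_algebra (V E : D) (c : Hom E V) (r : Hom E (S V))
    (i : Hom V E) :
  c ∘ i = idm V -> r ∘ i = eta S V ->
  exists (X : Algebra S) (u : Hom V X), compatible c r u /\
    forall (Y : Algebra S) (h : Hom V Y), compatible c r h ->
      exists! k : Hom X Y, algebra_hom k /\ k ∘ u = h.
Proof.
intros ci ri.
assert (refl : reflexive_pair (fmap S c) (mu S V ∘ fmap S r)).
{ exists (fmap S i); split.
  - now rewrite <- fmap_comp, ci, fmap_id.
  - now rewrite <- comp_assoc, <- fmap_comp, ri, mu_eta_r. }
destruct (coeq refl) as [X [q Hq]].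
pose proof (coeq_preserved refl Hq) as HSq.
pose proof (coeq_preserved (reflexive_pair_fmap S refl) HSq) as HSSq.
pose proof Hq as [e U].
rewrite comp_assoc in e.
destruct (proj2 HSq _ (q ∘ mu S V)) as [x [Hx _]].
{ rewrite fmap_comp, !comp_assoc.
  rewrite <- (comp_assoc q (mu S V) (fmap S (fmap S c))), mu_natural.
  rewrite comp_assoc, e.
  rewrite <- (comp_assoc q (mu S V) (fmap S (mu S V))), mu_assoc.
  rewrite comp_assoc, <- (comp_assoc _ (mu S (S V))), mu_natural.
  now rewrite comp_assoc. }
assert (xu : x ∘ eta S X = idm X).
{ apply (coequalizer_epi Hq); rewrite <- comp_assoc, eta_natural.
  now rewrite comp_assoc, Hx, <- comp_assoc, mu_eta_l, comp_idr, comp_idl. }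
assert (xa : x ∘ fmap S x = x ∘ mu S X).
{ apply (coequalizer_epi HSSq).
  rewrite <- comp_assoc, <- fmap_comp, Hx, fmap_comp, comp_assoc, Hx.
  rewrite <- (comp_assoc x), mu_natural, comp_assoc, Hx.
  now rewrite <- !comp_assoc, mu_assoc. }
assert (xq : x ∘ fmap S (q ∘ eta S V) = q).
{ now rewrite fmap_comp, comp_assoc, Hx, <- comp_assoc, mu_eta_r, comp_idr. }
exists {| alg_str := x; alg_unit := xu; alg_assoc := xa |}, (q ∘ eta S V).
split; unfold compatible, algebra_hom; simpl.
- rewrite xq, <- comp_assoc, eta_natural, comp_assoc, e.
  rewrite <- comp_assoc, <- eta_natural, <- comp_assoc.
  rewrite (comp_assoc (mu S V)), mu_eta_l; now rewrite comp_idl.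
- intros Y h Hh.
  assert (Sh : alg_str Y ∘ fmap S h ∘ mu S V
    = alg_str Y ∘ fmap S (alg_str Y ∘ fmap S h)).
  { rewrite <- comp_assoc, <- mu_natural, fmap_comp, !comp_assoc.
    now rewrite alg_assoc. }
  destruct (U _ (alg_str Y ∘ fmap S h)) as [k [Hk _]].
  { rewrite comp_assoc, Sh, <- !comp_assoc, <- !fmap_comp.
    now rewrite Hh. }
  exists k; split; [split|].
  + apply (coequalizer_epi HSq).
    now rewrite <- !comp_assoc, <- (fmap_comp S), Hk, Hx, comp_assoc, Hk, Sh.
  + rewrite comp_assoc, Hk, <- comp_assoc, <- eta_natural, comp_assoc.
    now rewrite alg_unit, comp_idl.
  + intros k' [ak' Hk']; apply (coequalizer_epi Hq); rewrite Hk, <- Hk'.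
    rewrite fmap_comp, comp_assoc, <- ak'.
    now rewrite <- comp_assoc, xq.
Qed.

End AlgebraCoequalizer.

(** * Equations of the structure morphisms of a category *)

Section StructureMorphisms.
Variables (C : Category) (pb : Pullbacks C) (T : Monad C).

Lemma composable_eq (A : TGraph T) (Q : C) (w w' : Hom Q (A2 pb A)) :
  d1 pb A ∘ w = d1 pb A ∘ w' -> c1 pb A ∘ w = c1 pb A ∘ w' -> w = w'.
Proof. exact (@pb_unique _ _ _ _ _ _ (pb2 pb A) Q w w'). Qed.

Lemma d1_i1 (A : PointedTGraph T) : d1 pb A ∘ i1 pb A = fmap T (pt A) ∘ d0 A.
Proof. exact (pb_fst_lift (pb2 pb A) (i1_comm A)). Qed.

Lemma c1_i1 (A : PointedTGraph T) : c1 pb A ∘ i1 pb A = idm (A1 A).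
Proof. exact (pb_snd_lift (pb2 pb A) (i1_comm A)). Qed.

Lemma d1_i2 (A : PointedTGraph T) : d1 pb A ∘ i2 pb A = eta T (A1 A).
Proof. exact (pb_fst_lift (pb2 pb A) (i2_comm A)). Qed.

Lemma c1_i2 (A : PointedTGraph T) : c1 pb A ∘ i2 pb A = pt A ∘ c0 A.
Proof. exact (pb_snd_lift (pb2 pb A) (i2_comm A)). Qed.

Section Associativity.
Variables (A : TGraph T) (m : Hom (A2 pb A) (A1 A)).
Hypothesis d0_m : d0 A ∘ m = mu T (A0 A) ∘ fmap T (d0 A) ∘ d1 pb A.
Hypothesis c0_m : c0 A ∘ m = c0 A ∘ c1 pb A.

Lemma d1_m1 : d1 pb A ∘ m1 c0_m = fmap T m ∘ d2 pb A.
Proof. exact (pb_fst_lift (pb2 pb A) (m1_comm c0_m)). Qed.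

Lemma c1_m1 : c1 pb A ∘ m1 c0_m = c1 pb A ∘ c2 pb A.
Proof. exact (pb_snd_lift (pb2 pb A) (m1_comm c0_m)). Qed.

Lemma d1_m2 : d1 pb A ∘ m2 d0_m = mu T (A1 A) ∘ fmap T (d1 pb A) ∘ d2 pb A.
Proof. exact (pb_fst_lift (pb2 pb A) (m2_comm d0_m)). Qed.

Lemma c1_m2 : c1 pb A ∘ m2 d0_m = m ∘ c2 pb A.
Proof. exact (pb_snd_lift (pb2 pb A) (m2_comm d0_m)). Qed.

End Associativity.
End StructureMorphisms.

(** * The monad of arrows out of a family *)

Section ArrowMonad.
Variables (C : Category) (pb : Pullbacks C) (T : Monad C) (B : TCategory pb T).

Definition Arr (X : Slice (A0 B)) : Slice (A0 B) :=
  {| slice_dom := pb_ob (pb (fmap T (slice_arr X)) (d0 B));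
     slice_arr := c0 B ∘ pb_snd (pb (fmap T (slice_arr X)) (d0 B)) |}.

Definition src (X : Slice (A0 B)) : Hom (slice_dom (Arr X)) (T (slice_dom X)) :=
  pb_fst _.

Definition arr (X : Slice (A0 B)) : Hom (slice_dom (Arr X)) (A1 B) :=
  pb_snd _.

Lemma src_arr (X : Slice (A0 B)) :
  fmap T (slice_arr X) ∘ src X = d0 B ∘ arr X.
Proof. exact (pb_comm _). Qed.

Lemma c0_arr (X : Slice (A0 B)) : c0 B ∘ arr X = slice_arr (Arr X).
Proof. reflexivity. Qed.

Definition arr_lift (X : Slice (A0 B)) (Q : C) (u : Hom Q (T (slice_dom X)))
    (v : Hom Q (A1 B)) (e : fmap T (slice_arr X) ∘ u = d0 B ∘ v) :
    Hom Q (slice_dom (Arr X)) :=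
  pb_lift _ e.

Lemma src_lift (X : Slice (A0 B)) (Q : C) (u : Hom Q (T (slice_dom X)))
    (v : Hom Q (A1 B)) (e : fmap T (slice_arr X) ∘ u = d0 B ∘ v) :
  src X ∘ arr_lift e = u.
Proof. exact (pb_fst_lift _ e). Qed.

Lemma arr_lift_arr (X : Slice (A0 B)) (Q : C) (u : Hom Q (T (slice_dom X)))
    (v : Hom Q (A1 B)) (e : fmap T (slice_arr X) ∘ u = d0 B ∘ v) :
  arr X ∘ arr_lift e = v.
Proof. exact (pb_snd_lift _ e). Qed.

Lemma arr_eq (X : Slice (A0 B)) (Q : C) (w w' : Hom Q (slice_dom (Arr X))) :
  src X ∘ w = src X ∘ w' -> arr X ∘ w = arr X ∘ w' -> w = w'.
Proof. exact (@pb_unique _ _ _ _ _ _ _ Q w w'). Qed.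

Lemma arr_map_comm (X Y : Slice (A0 B)) (f : Hom X Y) :
  fmap T (slice_arr Y) ∘ (fmap T (slice_map f) ∘ src X) = d0 B ∘ arr X.
Proof. now rewrite comp_assoc, (fmap_eq T (slice_comm f)), src_arr. Qed.

Definition arr_map (X Y : Slice (A0 B)) (f : Hom X Y) : Hom (Arr X) (Arr Y).
Proof.
exists (arr_lift (arr_map_comm f)).
now rewrite <- !c0_arr, <- comp_assoc, arr_lift_arr.
Defined.

Lemma src_map (X Y : Slice (A0 B)) (f : Hom X Y) :
  src Y ∘ slice_map (arr_map f) = fmap T (slice_map f) ∘ src X.
Proof. apply src_lift. Qed.

Lemma arr_map_arr (X Y : Slice (A0 B)) (f : Hom X Y) :
  arr Y ∘ slice_map (arr_map f) = arr X.
Proof. apply arr_lift_arr. Qed.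

Lemma arr_unit_comm (X : Slice (A0 B)) :
  fmap T (slice_arr X) ∘ eta T (slice_dom X)
  = d0 B ∘ (pt B ∘ slice_arr X).
Proof. now rewrite comp_assoc, d0_pt, eta_natural. Qed.

Definition arr_unit (X : Slice (A0 B)) : Hom X (Arr X).
Proof.
exists (arr_lift (arr_unit_comm X)).
now rewrite <- c0_arr, <- comp_assoc, arr_lift_arr, comp_assoc, c0_pt, comp_idl.
Defined.

Lemma src_unit (X : Slice (A0 B)) :
  src X ∘ slice_map (arr_unit X) = eta T (slice_dom X).
Proof. apply src_lift. Qed.

Lemma arr_unit_arr (X : Slice (A0 B)) :
  arr X ∘ slice_map (arr_unit X) = pt B ∘ slice_arr X.
Proof. apply arr_lift_arr. Qed.

Lemma arr_pair_comm (X : Slice (A0 B)) :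
  fmap T (c0 B) ∘ (fmap T (arr X) ∘ src (Arr X)) = d0 B ∘ arr (Arr X).
Proof. now rewrite comp_assoc, (fmap_eq T (c0_arr X)), src_arr. Qed.

(** An iterated pair consists of a family of arrows of [B] followed by an arrow
    out of their targets, hence of a composable pair of [B]. *)
Definition arr_pair (X : Slice (A0 B)) :
    Hom (slice_dom (Arr (Arr X))) (A2 pb B) :=
  pb_lift (pb2 pb B) (arr_pair_comm X).

Lemma d1_pair (X : Slice (A0 B)) :
  d1 pb B ∘ arr_pair X = fmap T (arr X) ∘ src (Arr X).
Proof. exact (pb_fst_lift (pb2 pb B) (arr_pair_comm X)). Qed.

Lemma c1_pair (X : Slice (A0 B)) : c1 pb B ∘ arr_pair X = arr (Arr X).
Proof. exact (pb_snd_lift (pb2 pb B) (arr_pair_comm X)). Qed.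

Lemma arr_mu_comm (X : Slice (A0 B)) :
  fmap T (slice_arr X) ∘ (mu T (slice_dom X) ∘ fmap T (src X) ∘ src (Arr X))
  = d0 B ∘ (mult B ∘ arr_pair X).
Proof.
rewrite !comp_assoc, <- mu_natural, d0_mult.
rw (fmap_eq T (src_arr X)). rw (d1_pair X).
rewrite fmap_comp, !comp_assoc. reflexivity.
Qed.

Definition arr_mu (X : Slice (A0 B)) : Hom (Arr (Arr X)) (Arr X).
Proof.
exists (arr_lift (arr_mu_comm X)).
rewrite <- !c0_arr, <- comp_assoc, arr_lift_arr, comp_assoc, c0_mult.
now rw (c1_pair X).
Defined.

Lemma src_mu (X : Slice (A0 B)) :
  src X ∘ slice_map (arr_mu X) = mu T (slice_dom X) ∘ fmap T (src X) ∘ src (Arr X).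
Proof. apply src_lift. Qed.

Lemma arr_mu_arr (X : Slice (A0 B)) :
  arr X ∘ slice_map (arr_mu X) = mult B ∘ arr_pair X.
Proof. apply arr_lift_arr. Qed.

Lemma arr_triple_comm (X : Slice (A0 B)) :
  fmap T (c1 pb B) ∘ (fmap T (arr_pair X) ∘ src (Arr (Arr X)))
  = d1 pb B ∘ arr_pair (Arr X).
Proof. now rewrite comp_assoc, (fmap_eq T (c1_pair X)), d1_pair. Qed.

(** Likewise for composable triples; this is how associativity of [B] gives
    associativity of the monad. *)
Definition arr_triple (X : Slice (A0 B)) :
    Hom (slice_dom (Arr (Arr (Arr X)))) (A3 pb B) :=
  pb_lift (pb3 pb B) (arr_triple_comm X).

Lemma d2_triple (X : Slice (A0 B)) :
  d2 pb B ∘ arr_triple X = fmap T (arr_pair X) ∘ src (Arr (Arr X)).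
Proof. exact (pb_fst_lift (pb3 pb B) (arr_triple_comm X)). Qed.

Lemma c2_triple (X : Slice (A0 B)) : c2 pb B ∘ arr_triple X = arr_pair (Arr X).
Proof. exact (pb_snd_lift (pb3 pb B) (arr_triple_comm X)). Qed.

Lemma arr_triple_m1 (X : Slice (A0 B)) :
  m1 (@c0_mult _ _ _ B) ∘ arr_triple X
  = arr_pair X ∘ slice_map (arr_map (arr_mu X)).
Proof.
apply composable_eq; rewrite !comp_assoc.
- rewrite d1_m1, d1_pair. rw (d2_triple X). rw (src_map (arr_mu X)).
  now rewrite (fmap_eq T (arr_mu_arr X)), fmap_comp.
- rewrite c1_m1, c1_pair, arr_map_arr. rw (c2_triple X). apply c1_pair.
Qed.

Lemma arr_triple_m2 (X : Slice (A0 B)) :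
  m2 (@d0_mult _ _ _ B) ∘ arr_triple X
  = arr_pair X ∘ slice_map (arr_mu (Arr X)).
Proof.
apply composable_eq; rewrite !comp_assoc.
- rewrite d1_m2, d1_pair. rw (d2_triple X). rw (src_mu (Arr X)).
  rw (fmap_eq T (d1_pair X)). rw (eq_sym (mu_natural T (arr X))).
  now rewrite fmap_comp, comp_assoc.
- rewrite c1_m2, c1_pair, arr_mu_arr. now rw (c2_triple X).
Qed.

Definition arr_functor : Functor (Slice (A0 B)) (Slice (A0 B)).
Proof.
refine {| fobj := Arr : Slice (A0 B) -> Slice (A0 B); fmap := arr_map |}.
- intros X; apply slice_hom_eq, arr_eq; cbn -[Arr arr_map].
  + now rewrite src_map; cbn [slice_map slice_id]; rewrite fmap_id, comp_idl, comp_idr.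
  + now rewrite arr_map_arr, comp_idr.
- intros X Y Z g f; apply slice_hom_eq, arr_eq; cbn -[Arr arr_map].
  + rewrite src_map; cbn [slice_map slice_comp]; rewrite comp_assoc. rw (src_map g).
    rw (src_map f). now rewrite fmap_comp.
  + rewrite comp_assoc. now rewrite !arr_map_arr.
Defined.

Definition arr_monad : Monad (Slice (A0 B)).
Proof.
refine {| monad_functor := arr_functor; eta := arr_unit; mu := arr_mu |};
  intros; apply slice_hom_eq, arr_eq;
  cbn -[Arr arr_map arr_unit arr_mu]; rewrite ?comp_assoc, ?comp_idr.
- rewrite src_unit, eta_natural. rw (src_map f). now rw (src_unit X).
- rewrite arr_unit_arr, arr_map_arr, <- comp_assoc, (slice_comm f).
  now rewrite arr_unit_arr.
- rewrite src_mu, src_map. rw (src_map (arr_map f)). rw (src_mu X).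
  rw (fmap_eq T (src_map f)). now rewrite fmap_comp, comp_assoc, mu_natural.
- rewrite arr_mu_arr, arr_map_arr, arr_mu_arr, <- comp_assoc.
  f_equal; apply composable_eq; rewrite comp_assoc.
  + rewrite !d1_pair. rw (src_map (arr_map f)).
    now rewrite (fmap_eq T (arr_map_arr f)).
  + now rewrite !c1_pair, arr_map_arr.
- rewrite src_mu. rw (src_unit (Arr X)).
  rw (eq_sym (eta_natural T (src X))).
  now rewrite mu_eta_l, comp_idl.
- rewrite arr_mu_arr, <- comp_assoc.
  transitivity (mult B ∘ (i2 pb B ∘ arr X)).
  + f_equal; apply composable_eq; rewrite !comp_assoc.
    * rewrite d1_pair, d1_i2. rw (src_unit (Arr X)). now rewrite eta_natural.
    * rewrite c1_pair, c1_i2, arr_unit_arr, <- comp_assoc. reflexivity.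
  + now rewrite comp_assoc, mult_i2, comp_idl.
- rewrite src_mu. rw (src_map (arr_unit X)). rw (fmap_eq T (src_unit X)).
  now rewrite mu_eta_r, comp_idl.
- rewrite arr_mu_arr, <- comp_assoc.
  transitivity (mult B ∘ (i1 pb B ∘ arr X)).
  + f_equal; apply composable_eq; rewrite !comp_assoc.
    * rewrite d1_pair, d1_i1. rw (src_map (arr_unit X)).
      rewrite (fmap_eq T (arr_unit_arr X)), fmap_comp.
      rewrite <- !comp_assoc; f_equal. apply src_arr.
    * now rewrite c1_pair, c1_i1, arr_map_arr, comp_idl.
  + now rewrite comp_assoc, mult_i1, comp_idl.
- rewrite !src_mu. rw (src_map (arr_mu X)). rw (fmap_eq T (src_mu X)).
  rw (src_mu (Arr X)). rewrite !fmap_comp, !comp_assoc.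
  rw (mu_assoc T (slice_dom X)). now rw (mu_natural T (src X)).
- rewrite !arr_mu_arr. rewrite <- !comp_assoc.
  rewrite <- (arr_triple_m1 X), <- (arr_triple_m2 X), !comp_assoc.
  now rewrite mult_assoc.
Defined.

(** [Arr X] and [Arr Y] are pullbacks of [d0 B], along [T (slice_arr X)] and
    [T (slice_arr Y)], so this is the cancellation property of pasted
    pullback squares. *)
Lemma arr_map_cartesian (X Y : Slice (A0 B)) (f : Hom X Y) :
  is_pullback (fmap T (slice_map f)) (src Y) (src X) (slice_map (arr_map f)).
Proof.
split; [now rewrite src_map|]; intros Q u v e.
assert (e' : fmap T (slice_arr X) ∘ u = d0 B ∘ (arr Y ∘ v)).
{ rewrite <- (slice_comm f), fmap_comp, <- comp_assoc, e, !comp_assoc.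
  now rewrite src_arr. }
exists (arr_lift e'); split; [split|].
- apply src_lift.
- apply arr_eq; rewrite comp_assoc.
  + now rewrite src_map, <- comp_assoc, src_lift.
  + now rewrite arr_map_arr, arr_lift_arr.
- intros w [<- <-]; apply arr_eq.
  + apply src_lift.
  + now rewrite arr_lift_arr, comp_assoc, arr_map_arr.
Qed.

(** By [arr_map_cartesian], [Arr] of a coequalizer diagram is the pullback along
    [src Z] of the diagram that T makes of it. *)
Lemma arr_preserves_reflexive_coequalizers :
  has_reflexive_coequalizers C ->
  reflexive_coequalizers_pullback_stable C ->
  preserves_reflexive_coequalizers T ->
  preserves_reflexive_coequalizers arr_monad.
Proof.
intros coeq stable preserved X Y Z f g q r Hq.
pose proof (slice_coequalizer_underlying coeq r Hq) as HqC.
apply slice_reflexive_pair in r.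
apply slice_coequalizer.
refine (stable _ _ _ _ _ _ (reflexive_pair_fmap T r) (preserved _ _ _ _ _ _ r HqC)
  _ (src Z) _ (src Y) _ _ (src X) (slice_map (arr_map (q ∘ f))) _ _
  (arr_map_cartesian q) _ (src_map f) _ (src_map g) _).
- rewrite <- fmap_comp. exact (arr_map_cartesian (q ∘ f)).
- exact (eq_sym (f_equal (@slice_map _ _ _ _) (fmap_comp arr_functor q f))).
- rewrite (proj1 Hq).
  exact (eq_sym (f_equal (@slice_map _ _ _ _) (fmap_comp arr_functor q g))).
Qed.

End ArrowMonad.

(** * Algebras as perfect functors *)

Section AlgebraCategory.
Variables (C : Category) (pb : Pullbacks C) (T : Monad C) (B : TCategory pb T).
Variables (V : Slice (A0 B)) (a : Hom (Arr V) V).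
Hypothesis a_unit :
  slice_map a ∘ slice_map (arr_unit V) = idm (slice_dom V).
Hypothesis a_assoc :
  slice_map a ∘ slice_map (arr_map a) = slice_map a ∘ slice_map (arr_mu V).

Lemma str_over : slice_arr V ∘ slice_map a = c0 B ∘ arr V.
Proof. exact (slice_comm a). Qed.

(** The graph whose objects are [V], whose arrows are the pairs making up
    [Arr V], and in which such a pair points to the result of its action. *)
Definition alg_graph : PointedTGraph T.
Proof.
refine {| pt_graph := {| A0 := slice_dom V; A1 := slice_dom (Arr V);
                         d0 := src V; c0 := slice_map a |};
          pt := slice_map (arr_unit V) |}; simpl A0; simpl d0; simpl c0.
- apply src_unit.
- exact a_unit.
Defined.

Lemma alg_d1_c1 : fmap T (slice_map a) ∘ d1 pb alg_graph = src V ∘ c1 pb alg_graph.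
Proof. exact (d1_c1 pb alg_graph). Qed.

Lemma alg_pair_comm :
  fmap T (slice_arr (Arr V)) ∘ d1 pb alg_graph
  = d0 B ∘ (arr V ∘ c1 pb alg_graph).
Proof.
rewrite comp_assoc, <- src_arr, <- comp_assoc, <- alg_d1_c1.
now rewrite <- c0_arr, <- str_over, fmap_comp, !comp_assoc.
Qed.

(** A composable pair of the graph is an element of [Arr (Arr V)], because the
    object that its second arrow starts from is determined by the first; the
    composition of the graph is then the multiplication of the monad. *)
Definition alg_pair : Hom (A2 pb alg_graph) (slice_dom (Arr (Arr V))) :=
  arr_lift alg_pair_comm.

Lemma src_alg_pair : src (Arr V) ∘ alg_pair = d1 pb alg_graph.
Proof. apply src_lift. Qed.

Lemma arr_alg_pair : arr (Arr V) ∘ alg_pair = arr V ∘ c1 pb alg_graph.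
Proof. apply arr_lift_arr. Qed.

(** Acting by the first arrows of a composable pair leaves its second arrow. *)
Lemma str_alg_pair :
  slice_map (arr_map a) ∘ alg_pair = c1 pb alg_graph.
Proof.
apply arr_eq; rewrite comp_assoc.
- rewrite src_map, <- comp_assoc, src_alg_pair. exact (d1_c1 pb alg_graph).
- now rewrite arr_map_arr, arr_alg_pair.
Qed.

Definition alg_mult : Hom (A2 pb alg_graph) (A1 alg_graph) :=
  slice_map (arr_mu V) ∘ alg_pair.

Lemma d0_alg_mult :
  d0 alg_graph ∘ alg_mult
  = mu T (A0 alg_graph) ∘ fmap T (d0 alg_graph) ∘ d1 pb alg_graph.
Proof.
unfold alg_mult; cbn [d0 alg_graph A0]; rewrite comp_assoc, src_mu.
now rw src_alg_pair.
Qed.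

Lemma c0_alg_mult :
  c0 alg_graph ∘ alg_mult = c0 alg_graph ∘ c1 pb alg_graph.
Proof.
unfold alg_mult; rewrite <- str_alg_pair, !comp_assoc; f_equal.
exact (eq_sym a_assoc).
Qed.

Lemma arr_pair_alg_pair_d1 :
  d1 pb B ∘ (arr_pair V ∘ alg_pair) = fmap T (arr V) ∘ d1 pb alg_graph.
Proof. rewrite comp_assoc, d1_pair. now rw src_alg_pair. Qed.

Lemma arr_pair_alg_pair_c1 :
  c1 pb B ∘ (arr_pair V ∘ alg_pair) = arr V ∘ c1 pb alg_graph.
Proof. now rewrite comp_assoc, c1_pair, arr_alg_pair. Qed.

Lemma alg_triple_comm :
  fmap T (slice_arr (Arr (Arr V))) ∘ (fmap T alg_pair ∘ d2 pb alg_graph)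
  = d0 B ∘ (arr V ∘ c1 pb alg_graph ∘ c2 pb alg_graph).
Proof.
rewrite <- c0_arr, fmap_comp, !comp_assoc.
rw (fmap_eq T arr_alg_pair). rewrite fmap_comp, comp_assoc.
rw (d2_c2 pb alg_graph).
rewrite <- fmap_comp, c0_arr, <- (comp_assoc (d0 B)).
exact (f_equal (fun w => w ∘ c2 pb alg_graph) alg_pair_comm).
Qed.

(** Composable triples correspond to elements of [Arr (Arr (Arr V))], and
    associativity becomes that of the monad. *)
Definition alg_triple :
    Hom (A3 pb alg_graph) (slice_dom (Arr (Arr (Arr V)))) :=
  arr_lift alg_triple_comm.

Lemma src_alg_triple :
  src (Arr (Arr V)) ∘ alg_triple = fmap T alg_pair ∘ d2 pb alg_graph.
Proof. apply src_lift. Qed.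

Lemma arr_alg_triple :
  arr (Arr (Arr V)) ∘ alg_triple = arr V ∘ c1 pb alg_graph ∘ c2 pb alg_graph.
Proof. apply arr_lift_arr. Qed.

Lemma alg_pair_m1 :
  alg_pair ∘ m1 c0_alg_mult = slice_map (arr_map (arr_mu V)) ∘ alg_triple.
Proof.
apply arr_eq; rewrite !comp_assoc.
- rewrite src_alg_pair, src_map, d1_m1. rw src_alg_triple.
  now rewrite <- fmap_comp.
- rewrite arr_alg_pair, arr_map_arr, arr_alg_triple.
  now rw (c1_m1 c0_alg_mult).
Qed.

Lemma alg_pair_m2 :
  alg_pair ∘ m2 d0_alg_mult = slice_map (arr_mu (Arr V)) ∘ alg_triple.
Proof.
apply arr_eq; rewrite !comp_assoc.
- rewrite src_alg_pair, src_mu, d1_m2. rw src_alg_triple.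
  now rw (fmap_eq T src_alg_pair).
- rewrite arr_alg_pair, arr_mu_arr. rw (c1_m2 d0_alg_mult).
  unfold alg_mult at 1; rewrite comp_assoc, arr_mu_arr, <- !comp_assoc.
  f_equal; apply composable_eq; rewrite !comp_assoc.
  + rewrite !d1_pair. rw src_alg_triple. rw (fmap_eq T arr_alg_pair).
    rw src_alg_pair. rewrite fmap_comp, <- !comp_assoc; f_equal.
    exact (eq_sym (d2_c2 pb alg_graph)).
  + now rewrite !c1_pair, arr_alg_pair, arr_alg_triple.
Qed.

Lemma alg_mult_assoc :
  alg_mult ∘ m1 c0_alg_mult = alg_mult ∘ m2 d0_alg_mult.
Proof.
unfold alg_mult at 1 3; rewrite <- !comp_assoc, alg_pair_m1, alg_pair_m2.
rewrite !comp_assoc; f_equal.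
exact (f_equal (@slice_map _ _ _ _) (mu_assoc (arr_monad B) V)).
Qed.

Definition alg_cat : TCategory pb T.
Proof.
refine {| tcat_graph := alg_graph; mult := alg_mult;
  d0_mult := d0_alg_mult; c0_mult := c0_alg_mult |}.
- transitivity (slice_map (arr_mu V) ∘ slice_map (arr_map (arr_unit V))).
  + unfold alg_mult; rewrite <- comp_assoc; f_equal.
    apply arr_eq; rewrite comp_assoc.
    (* The arrows of the graph are Arr V only up to conversion, so equations
       between maps out of them are chained by hand rather than rewritten. *)
    * rewrite src_alg_pair.
      exact (eq_trans (d1_i1 pb alg_graph) (eq_sym (src_map (arr_unit V)))).
    * rewrite arr_alg_pair, <- comp_assoc, c1_i1.
      exact (eq_trans (comp_idr _) (eq_sym (arr_map_arr (arr_unit V)))).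
  + exact (f_equal (@slice_map _ _ _ _) (mu_eta_r (arr_monad B) V)).
- transitivity (slice_map (arr_mu V) ∘ slice_map (arr_unit (Arr V))).
  + unfold alg_mult; rewrite <- comp_assoc; f_equal.
    apply arr_eq; rewrite comp_assoc.
    * rewrite src_alg_pair.
      exact (eq_trans (d1_i2 pb alg_graph) (eq_sym (src_unit (Arr V)))).
    * rewrite arr_alg_pair, <- comp_assoc, c1_i2.
      refine (eq_trans _ (eq_sym (arr_unit_arr (Arr V)))).
      change (arr V ∘ (slice_map (arr_unit V) ∘ slice_map a)
        = pt B ∘ slice_arr (Arr V)).
      now rewrite comp_assoc, arr_unit_arr, <- comp_assoc, str_over.
  + exact (f_equal (@slice_map _ _ _ _) (mu_eta_l (arr_monad B) V)).
- exact alg_mult_assoc.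
Defined.

Definition alg_proj : TFunctor alg_cat B.
Proof.
refine (@Build_TFunctor C pb T alg_cat B
  (@Build_TGraphHom C T alg_graph B (slice_arr V) (arr V)
     (eq_sym (src_arr V)) (eq_sym str_over)) _ _).
- apply arr_unit_arr.
- change (arr V ∘ (slice_map (arr_mu V) ∘ alg_pair)
    = mult B ∘ f2 pb (@Build_TGraphHom C T alg_graph B (slice_arr V) (arr V)
     (eq_sym (src_arr V)) (eq_sym str_over))).
  rewrite comp_assoc, arr_mu_arr, <- comp_assoc; f_equal.
  apply composable_eq.
  + rewrite arr_pair_alg_pair_d1, d1_f2. reflexivity.
  + rewrite arr_pair_alg_pair_c1, c1_f2. reflexivity.
Defined.

Lemma alg_proj_perfect : perfect alg_proj.
Proof.
split; [apply src_arr|]; intros Q u v e.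
exists (arr_lift e); split; [split|].
- apply src_lift.
- apply arr_lift_arr.
- intros w [<- <-]; apply arr_eq; [apply src_lift|apply arr_lift_arr].
Qed.

End AlgebraCategory.

(** * Perfect functors as algebras *)

Section PerfectFunctor.
Variables (C : Category) (pb : Pullbacks C) (T : Monad C) (Y B : TCategory pb T).
Variables (p : TFunctor Y B) (Hp : perfect p).

Lemma perfect_arrow_eq (Q : C) (w w' : Hom Q (A1 Y)) :
  d0 Y ∘ w = d0 Y ∘ w' -> f1 p ∘ w = f1 p ∘ w' -> w = w'.
Proof.
intros e e'; destruct (proj2 Hp Q (d0 Y ∘ w') (f1 p ∘ w')) as [x [_ U]].
- now rewrite !comp_assoc, d0_f1.
- now rewrite <- (U w (conj e e')), <- (U w' (conj eq_refl eq_refl)).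
Qed.

Lemma functor_into_perfect_eq (A : TCategory pb T) (F F' : TFunctor A Y) :
  f0 F = f0 F' -> tfunctor_comp p F = tfunctor_comp p F' -> F = F'.
Proof.
intros e e'; apply tfunctor_eq; [exact e|]; apply perfect_arrow_eq.
- now rewrite !d0_f1, e.
- exact (f_equal (fun G => f1 (tfun_hom G)) e').
Qed.

(** Identities and composites of [Y] are determined by their source and by their
    image in [B]; on sources the laws hold for any graph map, and in [B] they hold
    because [f] is a functor. *)
Lemma functor_into_perfect (A : TCategory pb T) (f : TFunctor A B)
    (F : TGraphHom A Y) :
  f0 p ∘ f0 F = f0 f -> f1 p ∘ f1 F = f1 f ->
  exists G : TFunctor A Y, tfun_hom G = F.
Proof.
intros e0 e1.
unshelve eexists {| tfun_hom := F |}; [| |reflexivity].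
- apply perfect_arrow_eq; rewrite !comp_assoc.
  + rewrite d0_f1, d0_pt. rw (d0_pt A). now rewrite eta_natural.
  + now rewrite e1, !f1_pt, <- comp_assoc, e0.
- apply perfect_arrow_eq; rewrite !comp_assoc.
  + rewrite d0_f1, d0_mult, <- comp_assoc, d0_mult, !comp_assoc.
    rw (d1_f2 pb F). rw (fmap_eq T (d0_f1 F)).
    now rewrite fmap_comp, comp_assoc, mu_natural.
  + rewrite e1, !f1_mult, <- comp_assoc; f_equal.
    apply composable_eq; rewrite !comp_assoc.
    * rewrite !d1_f2. rw (d1_f2 pb F). now rewrite (fmap_eq T e1).
    * rewrite !c1_f2. rw (c1_f2 pb F). now rewrite e1.
Qed.

End PerfectFunctor.

Section GraphOfFunctor.
Variables (C : Category) (pb : Pullbacks C) (T : Monad C) (A B : TCategory pb T).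
Variable f : TFunctor A B.

Definition objects_over : Slice (A0 B) :=
  {| slice_dom := A0 A; slice_arr := f0 f |}.

Definition arrows_over : Slice (A0 B) :=
  {| slice_dom := A1 A; slice_arr := f0 f ∘ c0 A |}.

Definition target : Hom arrows_over objects_over :=
  Build_SliceHom (X := arrows_over) (Y := objects_over) eq_refl.

(** An arrow of [A], remembered by its source in [A] and its image in [B]. *)
Definition image_arrow : Hom arrows_over (Arr objects_over).
Proof.
exists (arr_lift (X := objects_over) (eq_sym (d0_f1 f))).
rewrite <- c0_arr, <- comp_assoc, arr_lift_arr. apply c0_f1.
Defined.

Definition units : Hom objects_over arrows_over.
Proof.
exists (pt A); simpl.
now rewrite <- comp_assoc, c0_pt, comp_idr.
Defined.

Lemma src_image_arrow : src objects_over ∘ slice_map image_arrow = d0 A.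
Proof. apply src_lift. Qed.

Lemma arr_image_arrow : arr objects_over ∘ slice_map image_arrow = f1 f.
Proof. apply arr_lift_arr. Qed.

Lemma target_units : target ∘ units = idm objects_over.
Proof. apply slice_hom_eq, c0_pt. Qed.

Lemma image_arrow_units : image_arrow ∘ units = eta (arr_monad B) objects_over.
Proof.
apply slice_hom_eq, arr_eq; cbn [slice_map slice_comp comp Slice].
- rewrite comp_assoc, src_image_arrow.
  exact (eq_trans (d0_pt A) (eq_sym (src_unit objects_over))).
- rewrite comp_assoc, arr_image_arrow.
  exact (eq_trans (f1_pt f) (eq_sym (arr_unit_arr objects_over))).
Qed.

End GraphOfFunctor.

Section PerfectAlgebra.
Variables (C : Category) (pb : Pullbacks C) (T : Monad C) (Y B : TCategory pb T).
Variables (p : TFunctor Y B) (Hp : perfect p).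

Let V : Slice (A0 B) := objects_over p.

(** The lift of an arrow of [B] to a given source in [Y]; this is the inverse of
    the comparison between [Y1] and the pullback [Arr V]. *)
Definition arrow_lifting :
  {l : Hom (slice_dom (Arr V)) (A1 Y) | d0 Y ∘ l = src V /\ f1 p ∘ l = arr V}.
Proof.
apply constructive_indefinite_description.
destruct (proj2 Hp _ (src V) (arr V) (src_arr V)) as [l [Hl _]].
now exists l.
Defined.

Definition lift_arrow : Hom (slice_dom (Arr V)) (A1 Y) := proj1_sig arrow_lifting.

Lemma d0_lift : d0 Y ∘ lift_arrow = src V.
Proof. exact (proj1 (proj2_sig arrow_lifting)). Qed.

Lemma f1_lift : f1 p ∘ lift_arrow = arr V.
Proof. exact (proj2 (proj2_sig arrow_lifting)). Qed.

Definition perfect_str : Hom (Arr V) V.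
Proof.
exists (c0 Y ∘ lift_arrow).
change (f0 p ∘ (c0 Y ∘ lift_arrow) = slice_arr (Arr V)).
now rewrite comp_assoc, <- c0_f1, <- comp_assoc, f1_lift.
Defined.

Lemma lift_unit : lift_arrow ∘ slice_map (arr_unit V) = pt Y.
Proof.
apply (perfect_arrow_eq Hp); rewrite comp_assoc.
- rewrite d0_lift, src_unit; exact (eq_sym (d0_pt Y)).
- rewrite f1_lift, arr_unit_arr; exact (eq_sym (f1_pt p)).
Qed.

Lemma lift_pair_comm :
  fmap T (c0 Y) ∘ (fmap T lift_arrow ∘ src (Arr V))
  = d0 Y ∘ (lift_arrow ∘ slice_map (arr_map perfect_str)).
Proof.
rewrite !comp_assoc, d0_lift, src_map, <- fmap_comp. reflexivity.
Qed.

(** Lifting two composable arrows one after the other gives a composable pair. *)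
Definition lift_pair : Hom (slice_dom (Arr (Arr V))) (A2 pb Y) :=
  pb_lift (pb2 pb Y) lift_pair_comm.

Lemma d1_lift_pair : d1 pb Y ∘ lift_pair = fmap T lift_arrow ∘ src (Arr V).
Proof. exact (pb_fst_lift (pb2 pb Y) lift_pair_comm). Qed.

Lemma c1_lift_pair :
  c1 pb Y ∘ lift_pair = lift_arrow ∘ slice_map (arr_map perfect_str).
Proof. exact (pb_snd_lift (pb2 pb Y) lift_pair_comm). Qed.

(** The lift of a composite is the composite of the lifts, by uniqueness of
    lifts; this is the associativity of the action. *)
Lemma mult_lift_pair :
  mult Y ∘ lift_pair = lift_arrow ∘ slice_map (arr_mu V).
Proof.
apply (perfect_arrow_eq Hp); rewrite !comp_assoc.
- rewrite d0_lift, src_mu, d0_mult. rw d1_lift_pair.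
  now rw (fmap_eq T d0_lift).
- rewrite f1_lift, arr_mu_arr, f1_mult, <- comp_assoc; f_equal.
  apply composable_eq; rewrite !comp_assoc.
  + rewrite d1_f2, d1_pair. rw d1_lift_pair. now rewrite (fmap_eq T f1_lift).
  + rewrite c1_f2, c1_pair. rw c1_lift_pair.
    now rewrite f1_lift, arr_map_arr.
Qed.

Definition perfect_algebra : Algebra (arr_monad B).
Proof.
refine (@Build_Algebra _ (arr_monad B) V perfect_str _ _); apply slice_hom_eq.
- change (c0 Y ∘ lift_arrow ∘ slice_map (arr_unit V) = idm (A0 Y)).
  rewrite <- comp_assoc, lift_unit; exact (c0_pt Y).
- change (c0 Y ∘ lift_arrow ∘ slice_map (arr_map perfect_str)
    = c0 Y ∘ lift_arrow ∘ slice_map (arr_mu V)).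
  now rewrite <- !comp_assoc, <- c1_lift_pair, <- mult_lift_pair, !comp_assoc,
    c0_mult.
Defined.

Variables (A : TCategory pb T) (f : TFunctor A B).

Lemma functor_compatible (F : TFunctor A Y) (h : Hom (objects_over f) V) :
  f0 F = slice_map h -> f1 p ∘ f1 F = f1 f ->
  compatible (S := arr_monad B) (X := perfect_algebra) (target f) (image_arrow f) h.
Proof.
intros e0 e1; apply slice_hom_eq.
change (c0 Y ∘ lift_arrow ∘ slice_map (arr_map h) ∘ slice_map (image_arrow f)
  = slice_map h ∘ c0 A).
transitivity (c0 Y ∘ f1 F);
  [|exact (eq_trans (c0_f1 F) (f_equal (fun k => k ∘ c0 A) e0))].
rewrite <- !comp_assoc; f_equal.
apply (perfect_arrow_eq Hp); rewrite !comp_assoc.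
- rewrite d0_lift, src_map. rw (src_image_arrow f). rewrite <- e0.
  exact (eq_sym (d0_f1 F)).
- rewrite f1_lift, arr_map_arr, arr_image_arrow; exact (eq_sym e1).
Qed.

(** The arrow part is forced: an arrow of [A] goes to the lift of its image in
    [B] starting at the image of its source.  Compatibility is what makes this
    lift end at the right object. *)
Lemma compatible_functor (h : Hom (objects_over f) V) :
  compatible (S := arr_monad B) (X := perfect_algebra) (target f) (image_arrow f) h ->
  exists F : TFunctor A Y, f0 F = slice_map h /\ tfunctor_comp p F = f.
Proof.
intros H; apply (f_equal (@slice_map _ _ _ _)) in H.
change (c0 Y ∘ lift_arrow ∘ slice_map (arr_map h) ∘ slice_map (image_arrow f)
  = slice_map h ∘ c0 A) in H.
unshelve epose (F := Build_TGraphHom (A := A) (B := Y) (f0 := slice_map h)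
  (f1 := lift_arrow ∘ slice_map (arr_map h) ∘ slice_map (image_arrow f)) _ _).
- rewrite !comp_assoc, d0_lift, src_map. now rw (src_image_arrow f).
- now rewrite !comp_assoc.
- assert (e0 : f0 p ∘ f0 F = f0 f) by exact (slice_comm h).
  assert (e1 : f1 p ∘ f1 F = f1 f).
  { unfold F; cbn [f1]; rewrite !comp_assoc.
    now rewrite f1_lift, arr_map_arr, arr_image_arrow. }
  destruct (functor_into_perfect Hp e0 e1) as [G HG].
  exists G; rewrite HG; split; [reflexivity|].
  apply tfunctor_eq; simpl; now rewrite HG.
Qed.

End PerfectAlgebra.

(** The arrows of the category of an algebra are already the pairs in [Arr V], so
    lifting along its projection changes nothing. *)
Lemma perfect_str_alg (C : Category) (pb : Pullbacks C) (T : Monad C)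
    (B : TCategory pb T) (V : Slice (A0 B)) (a : Hom (Arr V) V)
    (au : slice_map a ∘ slice_map (arr_unit V) = idm (slice_dom V))
    (aa : slice_map a ∘ slice_map (arr_map a)
          = slice_map a ∘ slice_map (arr_mu V)) :
  slice_map (perfect_str (alg_proj_perfect au aa)) = slice_map a.
Proof.
change (slice_map a ∘ lift_arrow (alg_proj_perfect au aa) = slice_map a).
transitivity (slice_map a ∘ idm (slice_dom (Arr V))); [f_equal|apply comp_idr].
apply (arr_eq (X := V)).
- exact (eq_trans (d0_lift (alg_proj_perfect au aa)) (eq_sym (comp_idr _))).
- exact (eq_trans (f1_lift (alg_proj_perfect au aa)) (eq_sym (comp_idr _))).
Qed.

Lemma image_arrow_alg (C : Category) (pb : Pullbacks C) (T : Monad C)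
    (B : TCategory pb T) (V : Slice (A0 B)) (a : Hom (Arr V) V)
    (au : slice_map a ∘ slice_map (arr_unit V) = idm (slice_dom V))
    (aa : slice_map a ∘ slice_map (arr_map a)
          = slice_map a ∘ slice_map (arr_mu V)) :
  slice_map (image_arrow (alg_proj au aa)) = idm (slice_dom (Arr V)).
Proof.
apply (arr_eq (X := V)).
- exact (eq_trans (src_image_arrow (alg_proj au aa)) (eq_sym (comp_idr _))).
- exact (eq_trans (arr_image_arrow (alg_proj au aa)) (eq_sym (comp_idr _))).
Qed.

(** The reflection is the category of the universal algebra compatible with the
    graph of [A].  For a functor out of that category, compatibility means being
    an algebra homomorphism, so the universal property of the algebra is the one
    of the reflection. *)
Lemma perfect_reflection (C : Category) (pb : Pullbacks C) (T : Monad C)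
    (A B : TCategory pb T) (f : TFunctor A B) :
  has_reflexive_coequalizers C ->
  reflexive_coequalizers_pullback_stable C ->
  preserves_reflexive_coequalizers T ->
  exists (L : TCategory pb T) (p : TFunctor L B) (F : TFunctor A L),
    perfect p /\ tfunctor_comp p F = f /\
    forall (Y : TCategory pb T) (q : TFunctor Y B) (G : TFunctor A Y),
      perfect q -> tfunctor_comp q G = f ->
      exists! K : TFunctor L Y, tfunctor_comp q K = p /\ tfunctor_comp K F = G.
Proof.
intros coeq coeq_stable coeq_preserved.
destruct (universal_compatible_algebra
  (slice_has_reflexive_coequalizers coeq)
  (arr_preserves_reflexive_coequalizers coeq coeq_stable coeq_preserved)
  (target_units f) (image_arrow_units f)) as [[[L0 l] a au aa] [u [Hu U]]].
pose (V := {| slice_dom := L0; slice_arr := l |} : Slice (A0 B)).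
change (Hom (Arr V) V) in a; change (Hom (objects_over f) V) in u.
pose (au' := f_equal (@slice_map _ _ _ _) au
  : slice_map a ∘ slice_map (arr_unit V) = idm (slice_dom V)).
pose (aa' := f_equal (@slice_map _ _ _ _) aa
  : slice_map a ∘ slice_map (arr_map a) = slice_map a ∘ slice_map (arr_mu V)).
pose (p := alg_proj au' aa').
pose (Hp := alg_proj_perfect au' aa' : perfect p).
assert (Hu' : compatible (S := arr_monad B) (X := perfect_algebra Hp)
  (target f) (image_arrow f) u).
{ apply (f_equal (@slice_map _ _ _ _)) in Hu; apply slice_hom_eq.
  refine (eq_trans _ Hu).
  refine (f_equal (fun w => w ∘ slice_map (arr_map u) ∘ slice_map (image_arrow f)) _).
  exact (perfect_str_alg au' aa'). }
destruct (compatible_functor Hu') as [F [F0 Fp]].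
exists (alg_cat au' aa'), p, F; split; [exact Hp|split; [exact Fp|]].
intros Y q G Hq Gq.
assert (G0 : f0 q ∘ f0 G = f0 f)
  by exact (f_equal (fun K => f0 (tfun_hom K)) Gq).
assert (G1 : f1 q ∘ f1 G = f1 f)
  by exact (f_equal (fun K => f1 (tfun_hom K)) Gq).
pose (g := @Build_SliceHom C (A0 B) (objects_over f) (objects_over q)
  (f0 G) G0).
destruct (U (perfect_algebra Hq) g) as [k [[ak ku] Uk]].
{ exact (functor_compatible Hq (h := g) eq_refl G1). }
assert (hom_compatible : forall h : Hom (c := Slice (A0 B)) V (objects_over q),
  algebra_hom (S := arr_monad B) (X := Build_Algebra au aa) (Y := perfect_algebra Hq) h <->
  compatible (S := arr_monad B) (X := perfect_algebra Hq) (target p) (image_arrow p) h).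
{ intros h.
  pose (w := slice_map (perfect_str Hq) ∘ slice_map (arr_map h)).
  assert (e : w ∘ slice_map (image_arrow p) = w).
  { refine (eq_trans _ (comp_idr w)).
    exact (f_equal (fun v => w ∘ v) (image_arrow_alg au' aa')). }
  split; intros H; apply (f_equal (@slice_map _ _ _ _)) in H;
    apply slice_hom_eq.
  - exact (eq_trans e (eq_sym H)).
  - exact (eq_trans (eq_sym H) e). }
destruct (compatible_functor (proj1 (hom_compatible k) ak)) as [K [K0 Kp]].
exists K; split; [split|].
- exact Kp.
- apply (functor_into_perfect_eq Hq).
  + change (f0 K ∘ f0 F = f0 G).
    rewrite K0, F0; exact (f_equal (@slice_map _ _ _ _) ku).
  + rewrite Gq, <- Fp, <- Kp. apply tfunctor_eq; simpl; now rewrite comp_assoc.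
- intros K' [K'p K'F].
  assert (K'0 : f0 q ∘ f0 K' = f0 p)
    by exact (f_equal (fun K => f0 (tfun_hom K)) K'p).
  assert (K'1 : f1 q ∘ f1 K' = f1 p)
    by exact (f_equal (fun K => f1 (tfun_hom K)) K'p).
  pose (k' := @Build_SliceHom C (A0 B) V (objects_over q) (f0 K') K'0).
  apply (functor_into_perfect_eq Hq); [|now rewrite Kp, K'p].
  rewrite K0; change (slice_map k = slice_map k'); f_equal; apply Uk; split.
  + apply hom_compatible.
    exact (functor_compatible Hq (f := p) (h := k') eq_refl K'1).
  + apply slice_hom_eq; change (f0 K' ∘ slice_map u = f0 G).
    rewrite <- K'F; exact (f_equal (fun w => f0 K' ∘ w) (eq_sym F0)).
Qed.

Theorem theorem5p3 (C : Category) (pb : Pullbacks C) (T : Monad C)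
  (coeq : has_reflexive_coequalizers C)
  (coeq_stable : reflexive_coequalizers_pullback_stable C)
  (coeq_preserved : preserves_reflexive_coequalizers T)
  (B : CatT pb T) :
  reflective (C := Slice B) (perfect_over (pb := pb) (T := T) (B := B)).
Proof.
apply reflective_of_universal_arrows; intros [A f].
destruct (perfect_reflection f coeq coeq_stable coeq_preserved)
  as [L [p [F [Hp [Fp U]]]]].
pose (over := @Build_SliceOb (CatT pb T) B).
exists (over L p), (@Build_SliceHom (CatT pb T) B (over A f) (over L p) F Fp).
split; [exact Hp|]; intros [Y q] [G Gq] Hq.
destruct (U Y q G Hq Gq) as [K [[Kp KF] UK]].
exists (@Build_SliceHom (CatT pb T) B (over L p) (over Y q) K Kp).
split; [now apply slice_hom_eq|].
intros [K' K'p] e; apply slice_hom_eq; apply UK; split; [exact K'p|].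
exact (f_equal (@slice_map _ _ _ _) e).
Qed.
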